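(* Let $1\to N\to G\xrightarrow{\pi}Q\to1$ be a short exact sequence of groups and $M$ a $G$-module. Let $[f]\in H^2(G,M)_1$, where $f:G\times G\to M$ is a 2-cocycle with $f|_{N\times N}=0$. Then $\rho[f]\in H^1(Q,H^1(N,M))$ is represented by the derivation $Q\to H^1(N,M)$ sending $q$ to $[d_g]$, where $g\in G$ is any element with $\pi(g)=q$ and $d_g:N\to M$ is the derivation $$d_g(n)=f(g,g^{-1}ng)-f(n,g).$$
   Context: $N$ is regarded as a normal subgroup of $G$; $M$ is written additively. $H^1(N,M)=\mathrm{Der}(N,M)/\mathrm{Inn}(N,M)$ is a $Q$-module via $({}^gd)(n)=g\cdot d(g^{-1}ng)$. $H^2(G,M)_1=\ker(\mathrm{res}:H^2(G,M)\to H^2(N,M))$. The extension associated with a cocycle $f$ is $0\to M\to M\times_fG\to G\to1$, where $M\times_f G$ is the set $M\times G$ with law $(m,g)(m',g')=(m+g\cdot m'+f(g,g'),gg')$. Definition of $\rho:H^2(G,M)_1\to H^1(Q,H^1(N,M))$. Let $0\to M\xrightarrow{i}E\xrightarrow{p}G\to1$ have class in $H^2(G,M)_1$ and choose a homomorphism $s_0:N\to E$ with $p\circ s_0=\mathrm{id}_N$. For $x\in E$ let $({}^xs_0)(n)=x\,s_0(p(x)^{-1}np(x))\,x^{-1}$ and define $d_x\in\mathrm{Der}(N,M)$ by $i(d_x(n))=({}^xs_0)(n)s_0(n)^{-1}$. Then $\rho$ of the class of the extension is the class of the derivation $q\mapsto[d_x]$, for any $x\in E$ with $\pi(p(x))=q$;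 this class does not depend on the choices. *)

(* Defs.v *)
From HB Require Import structures.
From mathcomp Require Import all_boot all_algebra.
From mathcomp Require Import boolp functions.

Set Implicit Arguments.
Unset Strict Implicit.
Unset Printing Implicit Defensive.

Import GRing.Theory.
Local Open Scope ring_scope.
Local Open Scope quotient_scope.

Notation "{ 'ghom' G '->' H }" := (UMagmaMorphism.type G H)
  (at level 0, G at level 98, H at level 99, format "{ 'ghom'  G  ->  H }")
  : type_scope.

Reserved Notation "g *> m" (at level 40, left associativity).

HB.mixin Record Zmodule_isGModule (G : groupType) M of GRing.Zmodule M := {
  gact : G -> M -> M;
  gact1 : forall m, gact 1%g m = m;
  gactM : forall g h m, gact (g * h)%g m = gact g (gact h m);
  gactD : forall g m m', gact g (m + m') = gact g m + gact g m'
}.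

#[short(type="gmodType")]
HB.structure Definition GModule (G : groupType) :=
  {M of GRing.Zmodule M & Zmodule_isGModule G M}.

Notation "g *> m" := (gact g m) : ring_scope.

Section GModuleTheory.
Variables (G : groupType) (M : gmodType G).
Implicit Types (g : G) (m : M).

Lemma gact0 g : g *> (0 : M) = 0.
Proof. by apply: (addrI (g *> (0 : M))); rewrite -gactD !addr0. Qed.

Lemma gactN g m : g *> (- m) = - (g *> m).
Proof. by apply/eqP; rewrite -addr_eq0 -gactD addNr gact0. Qed.

Lemma gactB g m m' : g *> (m - m') = g *> m - g *> m'.
Proof. by rewrite gactD gactN. Qed.

Lemma gactK g m : g^-1%g *> (g *> m) = m.
Proof. by rewrite -gactM mulVg gact1. Qed.

Lemma gactKV g m : g *> (g^-1%g *> m) = m.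
Proof. by rewrite -gactM mulgV gact1. Qed.

End GModuleTheory.

(* Restriction of scalars along u; gres u M is M as an abelian group. *)
Definition gres (H G : groupType) (u : {ghom H -> G}) (M : gmodType G) : Type :=
  M.

Section Restriction.
Variables (H G : groupType) (u : {ghom H -> G}) (M : gmodType G).

HB.instance Definition _ := GRing.Zmodule.on (gres u M).

Definition gres_act (h : H) (m : gres u M) : gres u M := u h *> (m : M).

Fact gres_act1 m : gres_act 1%g m = m.
Proof. by rewrite /gres_act gmulf1 gact1. Qed.

Fact gres_actM g h m : gres_act (g * h)%g m = gres_act g (gres_act h m).
Proof. by rewrite /gres_act gmulfM gactM. Qed.

Fact gres_actD g m m' : gres_act g (m + m') = gres_act g m + gres_act g m'.
Proof. exact: gactD. Qed.

HB.instance Definition _ :=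
  Zmodule_isGModule.Build H (gres u M) gres_act1 gres_actM gres_actD.

Lemma gresE (h : H) (m : gres u M) : h *> m = u h *> (m : M) :> M.
Proof. by []. Qed.

End Restriction.

Section FirstCohomology.
Variables (G : groupType) (M : gmodType G).

Definition is_der : {pred G -> M} :=
  fun d => `[< forall g h, d (g * h)%g = d g + g *> d h >].

Fact is_der_zmod_closed : zmod_closed is_der.
Proof.
split=> [|d e /asboolP dP /asboolP eP]; apply/asboolP=> g h.
  by rewrite /= gact0 addr0.
by rewrite !fctE dP eP gactB opprD addrACA.
Qed.

HB.instance Definition _ := GRing.isZmodClosed.Build _ is_der is_der_zmod_closed.

Record der := Der { der_fun :> G -> M; _ : der_fun \in is_der }.

HB.instance Definition _ := [isSub for der_fun].
HB.instance Definition _ := [Choice of der by <:].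
HB.instance Definition _ := [SubChoice_isSubZmodule of der by <:].

Lemma derP (d : der) g h : d (g * h)%g = d g + g *> d h.
Proof. by case: d => d /= /asboolP. Qed.

Lemma derB (d e : der) g : (d - e) g = d g - e g.
Proof. by []. Qed.

Lemma derD (d e : der) g : (d + e) g = d g + e g.
Proof. by []. Qed.

Lemma der1 (d : der) : d 1%g = 0.
Proof.
by apply: (@addrI _ (d 1%g)); rewrite -{2}(gact1 (d 1%g)) -derP mulg1 addr0.
Qed.

Lemma derV (d : der) g : d g^-1%g = - (g^-1%g *> d g).
Proof. by apply/eqP; rewrite -addr_eq0 -derP mulVg der1. Qed.

Definition is_inn : {pred der} :=
  fun d => `[< exists m : M, forall g, d g = g *> m - m >].

Fact is_inn_zmod_closed : zmod_closed is_inn.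
Proof.
split=> [|d e /asboolP[m dE] /asboolP[m' eE]]; apply/asboolP.
  by exists 0 => g; rewrite gact0 subrr.
exists (m - m') => g; rewrite derB dE eE gactB !opprD !opprK.
by rewrite addrACA.
Qed.

HB.instance Definition _ := GRing.isZmodClosed.Build _ is_inn is_inn_zmod_closed.

Definition H1 : Type := Quotient.quot is_inn.

HB.instance Definition _ := GRing.Zmodule.on H1.
HB.instance Definition _ := EqQuotient.on H1.

Definition H1class (d : der) : H1 := \pi_H1 d.

End FirstCohomology.

Lemma H1class_eq (G : groupType) (M : gmodType G) (d e : der M) :
  H1class d = H1class e <-> exists m : M, forall g, d g - e g = g *> m - m.
Proof.
split=> [/eqP|[m dE]].
  by rewrite -Quotient.idealrBE => /asboolP.
by apply/eqP; rewrite -Quotient.idealrBE; apply/asboolP; exists m.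
Qed.

Lemma H1class_repr (G : groupType) (M : gmodType G) (c : H1 M) :
  H1class (repr c) = c.
Proof. exact: reprK. Qed.

Lemma H1classD (G : groupType) (M : gmodType G) (d e : der M) :
  H1class (d + e) = H1class d + H1class e.
Proof. exact: (@pi_addr _ _ _ _ _ (H1 M)). Qed.

Lemma H1class0 (G : groupType) (M : gmodType G) : H1class (0 : der M) = 0.
Proof. exact: (@pi_zeror _ _ _ _ _ (H1 M)). Qed.

Section SecondCohomology.
Variables (G : groupType) (M : gmodType G).

(* Cocycles are not assumed to be normalised. *)
Definition is_cocycle2 : {pred G -> G -> M} :=
  fun f => `[< forall g h k,
    f g h + f (g * h)%g k = g *> f h k + f g (h * k)%g >].

Fact is_cocycle2_zmod_closed : zmod_closed is_cocycle2.
Proof.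
split=> [|e f /asboolP eP /asboolP fP]; apply/asboolP=> g h k.
  by rewrite /= gact0.
by rewrite !fctE gactB addrACA -opprD eP fP opprD addrACA.
Qed.

HB.instance Definition _ :=
  GRing.isZmodClosed.Build _ is_cocycle2 is_cocycle2_zmod_closed.

Record cocycle2 := Cocycle2 {
  cocycle2_fun :> G -> G -> M;
  _ : cocycle2_fun \in is_cocycle2
}.

HB.instance Definition _ := [isSub for cocycle2_fun].
HB.instance Definition _ := [Choice of cocycle2 by <:].
HB.instance Definition _ := [SubChoice_isSubZmodule of cocycle2 by <:].

Lemma cocycle2P (f : cocycle2) g h k :
  f g h + f (g * h)%g k = g *> f h k + f g (h * k)%g.
Proof. by case: f => f /= /asboolP. Qed.

Lemma cocycle2B (e f : cocycle2) g h : (e - f) g h = e g h - f g h.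
Proof. by []. Qed.

Lemma cocycle2_1l (f : cocycle2) g : f 1%g g = f 1%g 1%g.
Proof.
have := cocycle2P f 1%g 1%g g; rewrite !mul1g gact1.
by move/addIr.
Qed.

Lemma cocycle2_1r (f : cocycle2) g : f g 1%g = g *> f 1%g 1%g.
Proof.
have := cocycle2P f g 1%g 1%g; rewrite !mulg1.
by move/addIr.
Qed.

Definition is_coboundary2 : {pred cocycle2} :=
  fun f => `[< exists b : G -> M, forall g h,
    f g h = g *> b h - b (g * h)%g + b g >].

Fact is_coboundary2_zmod_closed : zmod_closed is_coboundary2.
Proof.
split=> [|e f /asboolP[a eE] /asboolP[b fE]]; apply/asboolP.
  by exists (fun=> 0) => g h; rewrite gact0 subrr addr0.
exists (fun g => a g - b g) => g h; rewrite cocycle2B eE fE gactB.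
by rewrite !opprD !opprK; rewrite addrACA; congr (_ + _); rewrite addrACA.
Qed.

HB.instance Definition _ :=
  GRing.isZmodClosed.Build _ is_coboundary2 is_coboundary2_zmod_closed.

Definition H2 : Type := Quotient.quot is_coboundary2.

HB.instance Definition _ := GRing.Zmodule.on H2.
HB.instance Definition _ := EqQuotient.on H2.

Definition H2class (f : cocycle2) : H2 := \pi_H2 f.

End SecondCohomology.

Lemma H2class_eq (G : groupType) (M : gmodType G) (e f : cocycle2 M) :
  H2class e = H2class f <-> exists b : G -> M, forall g h,
    e g h - f g h = g *> b h - b (g * h)%g + b g.
Proof.
split=> [/eqP|[b eE]].
  by rewrite -Quotient.idealrBE => /asboolP.
by apply/eqP; rewrite -Quotient.idealrBE; apply/asboolP; exists b.
Qed.

Lemma H2class_repr (G : groupType) (M : gmodType G) (c : H2 M) :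
  H2class (repr c) = c.
Proof. exact: reprK. Qed.

Lemma H2class0 (G : groupType) (M : gmodType G) : H2class (0 : cocycle2 M) = 0.
Proof. exact: (@pi_zeror _ _ _ _ _ (H2 M)). Qed.

Section RestrictionH2.
Variables (H G : groupType) (u : {ghom H -> G}) (M : gmodType G).

Definition res2_fun (f : cocycle2 M) : H -> H -> gres u M :=
  fun x y => f (u x) (u y).

Fact res2_fun_cocycle f : res2_fun f \in is_cocycle2 (M := gres u M).
Proof.
by apply/asboolP=> g h k; rewrite gresE /res2_fun !gmulfM; exact: (cocycle2P f (u g) (u h) (u k)).
Qed.

Definition res2 (f : cocycle2 M) : cocycle2 (gres u M) :=
  Cocycle2 (res2_fun_cocycle f).

Definition H2res (c : H2 M) : H2 (gres u M) := H2class (res2 (repr c)).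

Lemma H2res_class f : H2res (H2class f) = H2class (res2 f).
Proof.
apply/H2class_eq; have /H2class_eq[b bE] := H2class_repr (H2class f).
by exists (b \o u) => g h; rewrite /= gmulfM; apply: bE.
Qed.

End RestrictionH2.

Record ses (N G Q : groupType) := Ses {
  ses_incl : {ghom N -> G};
  ses_proj : {ghom G -> Q};
  ses_incl_inj : injective ses_incl;
  ses_proj_surj : forall q, exists g, ses_proj g = q;
  ses_exact : forall g, ses_proj g = 1%g <-> exists n, ses_incl n = g
}.

Section ShortExactSequence.
Variables (N G Q : groupType) (S : ses N G Q) (M : gmodType G).
Local Notation iota := (ses_incl S).
Local Notation pi := (ses_proj S).

Fact ses_conj_subproof (n : N) (g : G) : exists n', iota n' = (iota n ^ g)%g.
Proof.
apply/ses_exact; rewrite gmulfJ.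
have -> : pi (iota n) = 1%g by apply/ses_exact; exists n.
by rewrite conj1g.
Qed.

(* The element of N whose image in G is g^-1 n g; existence is exactness. *)
Definition ses_conj (n : N) (g : G) : N := projT1 (cid (ses_conj_subproof n g)).

Lemma ses_conjE n g : iota (ses_conj n g) = (g^-1 * iota n * g)%g.
Proof. by rewrite -mulgA -/(conjg _ _) /ses_conj; case: cid. Qed.

Lemma ses_conjM n g h : ses_conj n (g * h)%g = ses_conj (ses_conj n g) h.
Proof. by apply: (@ses_incl_inj _ _ _ S); rewrite !ses_conjE invgM !mulgA. Qed.

Lemma ses_conj1 n : ses_conj n 1%g = n.
Proof. by apply: (@ses_incl_inj _ _ _ S); rewrite !ses_conjE invg1 mul1g mulg1. Qed.

Lemma ses_conjMl m n g :
  ses_conj (m * n)%g g = (ses_conj m g * ses_conj n g)%g.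
Proof.
apply: (@ses_incl_inj _ _ _ S); rewrite gmulfM !ses_conjE gmulfM.
by rewrite !mulgA mulgK.
Qed.

Lemma ses_conj_incl m n : ses_conj m (iota n) = (n^-1 * m * n)%g.
Proof.
by apply: (@ses_incl_inj _ _ _ S); rewrite !ses_conjE !gmulfM gmulfV.
Qed.

Definition derN := der (gres iota M).
HB.instance Definition _ := GRing.Zmodule.on derN.

Definition H1N : Type := H1 (gres iota M).
HB.instance Definition _ := GRing.Zmodule.on H1N.

Definition derconj_fun (g : G) (d : derN) : N -> gres iota M :=
  fun n => g *> (d (ses_conj n g) : M).

Fact derconj_fun_der g d : derconj_fun g d \in is_der (M := gres iota M).
Proof.
apply/asboolP=> m n; rewrite /derconj_fun ses_conjMl derP !gresE.
by rewrite gactD -gactM ses_conjE !mulgA mulgV mul1g gactM.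
Qed.

Definition derconj (g : G) (d : derN) : derN := Der (derconj_fun_der g d).

Lemma derconjE g d n : derconj g d n = g *> (d (ses_conj n g) : M) :> M.
Proof. by []. Qed.

(* The action of q lifts q to some g in G and conjugates a representative by g;
   H1N_actE shows that the choices are irrelevant. *)
Definition ses_lift (q : Q) : G := projT1 (cid (ses_proj_surj S q)).

Lemma ses_liftK q : pi (ses_lift q) = q.
Proof. by rewrite /ses_lift; case: cid. Qed.

Definition H1N_act (q : Q) (c : H1N) : H1N :=
  H1class (derconj (ses_lift q) (repr c)).

Lemma derconj_class g (d e : derN) :
  H1class d = H1class e -> H1class (derconj g d) = H1class (derconj g e).
Proof.
move=> /H1class_eq[m dE]; apply/H1class_eq; exists (g *> (m : M)) => n.
have := dE (ses_conj n g); rewrite !gresE => /(congr1 (@gact G M g)).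
by rewrite !gactB -!gactM ses_conjE !mulgA mulgV mul1g.
Qed.

Lemma derconjM g h (d : derN) : derconj (g * h)%g d = derconj g (derconj h d).
Proof.
by apply/val_inj/funext=> n /=; rewrite /derconj_fun /= ses_conjM gactM.
Qed.

Lemma derconj1 (d : derN) : derconj 1%g d = d.
Proof.
by apply/val_inj/funext=> n /=; rewrite /derconj_fun /= ses_conj1 gact1.
Qed.

Lemma derconjD g (d e : derN) : derconj g (d + e) = derconj g d + derconj g e.
Proof. by apply/val_inj/funext=> n; exact: (@gactD _ M). Qed.

Lemma derconj_incl n (d : derN) : H1class (derconj (iota n) d) = H1class d.
Proof.
apply/H1class_eq; exists (d n) => m.
have -> : derconj (iota n) d m = n *> d (n^-1 * m * n)%g.
  by rewrite derconjE ses_conj_incl.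
rewrite !derP derV !gactD gactN !gactKV -gactM mulVKg.
by rewrite addrAC addrK addrC.
Qed.

Lemma H1N_actE g (d : derN) : H1N_act (pi g) (H1class d) = H1class (derconj g d).
Proof.
rewrite /H1N_act; set d' := repr _; set h := ses_lift _.
have d'E : H1class d' = H1class d by exact: H1class_repr.
have [n nE] : exists n, iota n = (g^-1 * h)%g.
  by apply/ses_exact; rewrite gmulfM gmulfV ses_liftK mulVg.
have -> : h = (g * iota n)%g by rewrite nE mulVKg.
by rewrite derconjM; apply: derconj_class; rewrite derconj_incl.
Qed.

Fact H1N_act1 c : H1N_act 1%g c = c.
Proof.
by rewrite -[c]H1class_repr -(gmulf1 : pi 1%g = 1%g) H1N_actE derconj1.
Qed.

Fact H1N_actM p q c : H1N_act (p * q)%g c = H1N_act p (H1N_act q c).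
Proof.
rewrite -[c]H1class_repr -[p]ses_liftK -[q]ses_liftK -gmulfM.
by rewrite !H1N_actE derconjM.
Qed.

Fact H1N_actD q c e : H1N_act q (c + e) = H1N_act q c + H1N_act q e.
Proof.
rewrite -[c]H1class_repr -[e]H1class_repr -[q]ses_liftK.
rewrite -[LHS]/(H1N_act _ (H1class _ + H1class _)).
by rewrite -H1classD !H1N_actE derconjD H1classD.
Qed.

HB.instance Definition _ :=
  Zmodule_isGModule.Build Q H1N H1N_act1 H1N_actM H1N_actD.

End ShortExactSequence.

(* 0 -> M -> E -> G -> 1 inducing the given action of G on M. *)
Record extension (G : groupType) (M : gmodType G) := Extension {
  ext_grp :> groupType;
  ext_incl : M -> ext_grp;
  ext_proj : {ghom ext_grp -> G};
  ext_inclD : forall m m', ext_incl (m + m') = (ext_incl m * ext_incl m')%g;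
  ext_incl_inj : injective ext_incl;
  ext_proj_surj : forall g, exists x, ext_proj x = g;
  ext_exact : forall x, ext_proj x = 1%g <-> exists m, ext_incl m = x;
  ext_act : forall x m,
    (x * ext_incl m * x^-1)%g = ext_incl (ext_proj x *> m)
}.

Definition ext_equiv (G : groupType) (M : gmodType G) (E E' : extension M) :
    Prop :=
  exists phi : {ghom E -> E'},
    (forall m, phi (ext_incl E m) = ext_incl E' m) /\
    (forall x, ext_proj E' (phi x) = ext_proj E x).

Definition twisted (G : groupType) (M : gmodType G) (f : cocycle2 M) : Type :=
  (M * G)%type.

Section TwistedProduct.
Variables (G : groupType) (M : gmodType G) (f : cocycle2 M).
Implicit Types x y z : twisted f.

HB.instance Definition _ := Choice.on (twisted f).

Definition twisted_mul x y : twisted f :=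
  (x.1 + x.2 *> y.1 + f x.2 y.2, (x.2 * y.2)%g).

(* f is not normalised, so the unit is (- f(1,1), 1). *)
Definition twisted_one : twisted f := (- f 1%g 1%g, 1%g).

Definition twisted_inv x : twisted f :=
  (- f 1%g 1%g - f x.2^-1%g x.2 - x.2^-1%g *> x.1, x.2^-1%g).

Fact twisted_mulA : associative twisted_mul.
Proof.
move=> [m g] [n h] [p k]; congr (_, _); rewrite /= ?mulgA //.
rewrite !gactD gactM -!addrA; congr (_ + (_ + _)).
rewrite [in RHS]addrCA; congr (_ + _).
by rewrite -cocycle2P.
Qed.

Fact twisted_mul1 : left_id twisted_one twisted_mul.
Proof.
move=> [m g]; congr (_, _); rewrite /= ?mul1g //.
by rewrite gact1 (cocycle2_1l f g) addrAC addNr add0r.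
Qed.

Fact twisted_mulr1 : right_id twisted_one twisted_mul.
Proof.
move=> [m g]; congr (_, _); rewrite /= ?mulg1 //.
by rewrite gactN (cocycle2_1r f g) subrK.
Qed.

Fact twisted_mulV : left_inverse twisted_one twisted_inv twisted_mul.
Proof.
move=> [m g]; congr (_, _); rewrite /= ?mulVg //.
by rewrite subrK subrK.
Qed.

Fact twisted_mulrV : right_inverse twisted_one twisted_inv twisted_mul.
Proof.
move=> [m g]; congr (_, _); rewrite /= ?mulgV //.
rewrite !gactB gactN gactKV.
have := cocycle2P f g g^-1%g g.
rewrite mulgV mulVg (cocycle2_1l f g) (cocycle2_1r f g) => /eqP.
rewrite -subr_eq => /eqP <-.
rewrite -opprD [X in - X]addrC subrK opprD [m + _]addrC subrK.
by rewrite addrAC addNr add0r.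
Qed.

HB.instance Definition _ := isGroup.Build (twisted f) twisted_mulA twisted_mul1
  twisted_mulr1 twisted_mulV twisted_mulrV.

Definition twisted_proj (x : twisted f) : G := x.2.

Fact twisted_proj_morph : monoid.monoid_morphism twisted_proj.
Proof. by []. Qed.

HB.instance Definition _ :=
  isUMagmaMorphism.Build (twisted f) G twisted_proj twisted_proj_morph.

Definition twisted_incl (m : M) : twisted f := (m - f 1%g 1%g, 1%g).

Lemma twisted_mulE x y :
  (x * y)%g = (x.1 + x.2 *> y.1 + f x.2 y.2, (x.2 * y.2)%g) :> twisted f.
Proof. by []. Qed.

Fact twisted_inclD m m' :
  twisted_incl (m + m') = (twisted_incl m * twisted_incl m')%g.
Proof.
rewrite twisted_mulE; congr (_, _); rewrite /= ?mulg1 // gact1.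
by rewrite addrA subrK addrAC.
Qed.

Fact twisted_incl_inj : injective twisted_incl.
Proof. by move=> m m' [] /addIr. Qed.

Fact twisted_proj_surj g : exists x, twisted_proj x = g.
Proof. by exists (0, g). Qed.

Fact twisted_exact x : twisted_proj x = 1%g <-> exists m, twisted_incl m = x.
Proof.
case: x => m g; split=> [/= ->|[m' [_ <-]] //].
by exists (m + f 1%g 1%g); rewrite /twisted_incl addrK.
Qed.

Fact twisted_act x m :
  (x * twisted_incl m * x^-1)%g = twisted_incl (twisted_proj x *> m).
Proof.
apply: (canLR (mulgK _)); rewrite !twisted_mulE; case: x => n g /=.
rewrite mulg1 mul1g gact1 gactB (cocycle2_1l f g) (cocycle2_1r f g).
congr pair.
by rewrite addrA subrK addrAC subrK addrC.
Qed.

Definition twisted_ext : extension M :=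
  @Extension G M (twisted f) twisted_incl twisted_proj twisted_inclD
    twisted_incl_inj twisted_proj_surj twisted_exact twisted_act.

End TwistedProduct.

Definition ext_class (G : groupType) (M : gmodType G) (E : extension M)
    (c : H2 M) : Prop :=
  exists f : cocycle2 M, H2class f = c /\ ext_equiv E (twisted_ext f).

Record partial_splitting (N G Q : groupType) (S : ses N G Q) (M : gmodType G)
    (E : extension M) := PartialSplitting {
  psplit :> {ghom N -> E};
  psplitP : forall n, ext_proj E (psplit n) = ses_incl S n
}.

Section RhoOfExtension.
Variables (N G Q : groupType) (S : ses N G Q) (M : gmodType G).
Variables (E : extension M) (s0 : partial_splitting S E).
Local Notation iota := (ses_incl S).
Local Notation pi := (ses_proj S).
Local Notation i := (ext_incl E).
Local Notation p := (ext_proj E).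

Definition psplit_conj (x : E) (n : N) : E :=
  (x * s0 (ses_conj S n (p x)) * x^-1)%g.

Fact dx_subproof (x : E) (n : N) :
  exists m : M, i m = (psplit_conj x n * (s0 n)^-1)%g.
Proof.
apply/ext_exact; rewrite !gmulfM !gmulfV !psplitP ses_conjE.
by rewrite !mulgA mulgV mul1g mulgK mulgV.
Qed.

Definition dx_fun (x : E) : N -> gres iota M :=
  fun n => projT1 (cid (dx_subproof x n)).

Lemma dx_funE x n :
  i (dx_fun x n) = (x * s0 (ses_conj S n (p x)) * x^-1 * (s0 n)^-1)%g.
Proof. by rewrite /dx_fun; case: cid. Qed.

Fact dx_fun_der x : dx_fun x \in is_der (M := gres iota M).
Proof.
apply/asboolP=> m n; apply: (@ext_incl_inj _ _ E).
rewrite (@ext_inclD _ _ E) gresE -(psplitP s0) -ext_act !dx_funE.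
by rewrite ses_conjMl !gmulfM invgM !mulgA !mulgVK.
Qed.

Definition dx (x : E) : derN S M := Der (dx_fun_der x).

Lemma dxE x n :
  i (dx x n) = (x * s0 (ses_conj S n (p x)) * x^-1 * (s0 n)^-1)%g.
Proof. exact: dx_funE. Qed.

Lemma dxM x y : dx (x * y)%g = dx x + derconj (p x) (dx y).
Proof.
apply/val_inj/funext=> n; apply: (@ext_incl_inj _ _ E).
rewrite [RHS](_ : _ = i (derconj (p x) (dx y) n + dx x n)); last first.
  by rewrite addrC.
rewrite (@ext_inclD _ _ E) derconjE -ext_act !dxE.
by rewrite gmulfM ses_conjM invgM !mulgA !mulgVK.
Qed.

Lemma ext_proj_incl m : p (i m) = 1%g.
Proof. by apply/ext_exact; exists m. Qed.

Lemma ext_incl0 : i 0 = 1%g.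
Proof. by apply: (@mulgI _ (i 0)); rewrite -ext_inclD addr0 mulg1. Qed.

Lemma ext_inclN m : i (- m) = (i m)^-1%g.
Proof. by apply: (@mulgI _ (i m)); rewrite -ext_inclD subrr mulgV ext_incl0. Qed.

Lemma ext_inclC m m' : (i m * i m' = i m' * i m)%g.
Proof. by rewrite -!ext_inclD addrC. Qed.

Lemma dx_incl m : H1class (dx (i m)) = 0.
Proof.
rewrite -H1class0; apply/H1class_eq; exists (- (m : M)) => n.
apply: (@ext_incl_inj _ _ E); rewrite subr0 opprK gresE (@ext_inclD _ _ E).
rewrite ext_inclC -(psplitP s0) -ext_act ext_inclN.
by rewrite dxE ext_proj_incl ses_conj1 !mulgA.
Qed.

Lemma dx_psplit n : dx (s0 n) = 0.
Proof.
apply/val_inj/funext=> n'; apply: (@ext_incl_inj _ _ E).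
rewrite dxE psplitP ses_conj_incl [RHS]ext_incl0.
by rewrite !gmulfM gmulfV !mulgA mulgV mul1g mulgK mulgV.
Qed.

(* q is sent to [d_x] for a chosen x over q; rho_funE covers every other x. *)
Definition rho_fun (q : Q) : H1N S M :=
  H1class (dx (projT1 (cid (ext_proj_surj E (ses_lift S q))))).

Lemma rho_funE x : rho_fun (pi (p x)) = H1class (dx x).
Proof.
rewrite /rho_fun; case: cid => y /= yE.
have [n nE] : exists n, iota n = (p x / p y)%g.
  by apply/ses_exact; rewrite gmulfM gmulfV yE ses_liftK mulgV.
have [m mE] : exists m, i m = (x / (s0 n * y))%g.
  apply/ext_exact; rewrite gmulfM gmulfV gmulfM psplitP nE.
  by rewrite mulgVK mulgV.
have -> : x = (i m * (s0 n * y))%g by rewrite mE mulgVK.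
rewrite !dxM dx_psplit add0r H1classD dx_incl add0r psplitP ext_proj_incl.
by rewrite derconj1 derconj_incl.
Qed.

Fact rho_fun_der : rho_fun \in is_der (M := H1N S M).
Proof.
apply/asboolP=> q r.
have [g <-] := ses_proj_surj S q; have [h <-] := ses_proj_surj S r.
have [x <-] := ext_proj_surj E g; have [y <-] := ext_proj_surj E h.
rewrite -!gmulfM !rho_funE dxM H1classD; congr (_ + _).
by rewrite -H1N_actE.
Qed.

Definition rho_der : der (H1N S M) := Der rho_fun_der.

Lemma rho_derE x : rho_der (pi (p x)) = H1class (dx x).
Proof. exact: rho_funE. Qed.

Definition rho_ext : H1 (H1N S M) := H1class rho_der.

End RhoOfExtension.

Definition H2_1 (N G Q : groupType) (S : ses N G Q) (M : gmodType G) : Type :=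
  {c : H2 M | H2res (ses_incl S) c == 0}.

Section Rho.
Variables (N G Q : groupType) (S : ses N G Q) (M : gmodType G).

Lemma split_ext_exists (c : H2_1 S M) :
  exists w : {E : extension M & partial_splitting S E},
    ext_class (projT1 w) (sval c).
Proof.
case: c => c /= /eqP c1; set f := repr c.
have [b bE] : exists b : N -> M, forall m n,
    f (ses_incl S m) (ses_incl S n)
    = ses_incl S m *> b n - b (m * n)%g + b m.
  have /H2class_eq[b bE] : H2class (res2 (ses_incl S) f) = H2class 0.
    by rewrite H2class0.
  by exists b => m n; rewrite -[LHS](subr0 _); apply: bE.
pose s n : twisted_ext f := (- b n, ses_incl S n).
have sM : {morph s : m n / (m * n)%g}.
  move=> m n; rewrite [RHS]twisted_mulE /= -gmulfM; congr (_, _).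
  by rewrite bE gactN -opprD [RHS]addrC opprD addrA addrK addrAC subrr add0r.
have s1 : s 1%g = 1%g.
  by apply: (@mulgI _ (s 1%g)); rewrite -sM !mulg1.
pose s0 : {ghom N -> twisted_ext f} := HB.pack s
  (isUMagmaMorphism.Build N (twisted_ext f) s (s1, sM)).
have s0P n : ext_proj (twisted_ext f) (s0 n) = ses_incl S n by [].
exists (existT _ (twisted_ext f) (PartialSplitting s0P)) => /=.
exists f; split; first exact: H2class_repr.
by exists (idfun : {ghom twisted_ext f -> twisted_ext f}); split.
Qed.

(* An extension in the class and a lift s0 are picked by choice; by rhoE below,
   every other pick gives the same value. *)
Definition rho (c : H2_1 S M) : H1 (H1N S M) :=
  rho_ext (projT2 (projT1 (cid (split_ext_exists c)))).

Lemma rhoP (c : H2_1 S M) :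
  exists (E : extension M) (s0 : partial_splitting S E),
    ext_class E (sval c) /\ rho c = rho_ext s0.
Proof.
by rewrite /rho; case: cid => -[E s0] /= cE; exists E, s0.
Qed.

End Rho.

Section RhoIndependence.
Variables (N G Q : groupType) (S : ses N G Q) (M : gmodType G).
Local Notation iota := (ses_incl S).
Local Notation pi := (ses_proj S).

Lemma rho_ext_split (E : extension M) (s s' : partial_splitting S E) :
  rho_ext s = rho_ext s'.
Proof.
have /choice[e eE] n : exists m, ext_incl E m = (s n * (s' n)^-1)%g.
  by apply/ext_exact; rewrite gmulfM gmulfV !psplitP mulgV.
have eder : (e : N -> gres iota M) \in is_der (M := gres iota M).
  apply/asboolP=> m n; apply: (@ext_incl_inj _ _ E).
  rewrite (@ext_inclD _ _ E) gresE -(psplitP s) ext_inclC -ext_act !eE.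
  have -> : (s m * (s n / s' n) / s m * (s m / s' m) =
             s m * s n / s' n / s' m)%g by rewrite !mulgA mulgVK.
  by rewrite !gmulfM invgM !mulgA.
apply/H1class_eq; exists (H1class (Der eder : derN S M)) => q.
have [g <-] := ses_proj_surj S q; have [x <-] := ext_proj_surj E g.
rewrite !rho_derE -[_ *> _]/(H1N_act _ _) H1N_actE.
have dE : dx s x + (Der eder : derN S M) =
          derconj (ext_proj E x) (Der eder) + dx s' x.
  apply/val_inj/funext=> n; apply: (@ext_incl_inj _ _ E).
  rewrite [LHS](@ext_inclD _ _ E) [RHS](@ext_inclD _ _ E).
  rewrite -[\val (derconj _ _) n]/(derconj (ext_proj E x) (Der eder) n).
  by rewrite derconjE -ext_act (dxE s) (dxE s') /= !eE !mulgA !mulgVK.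
have := congr1 (@H1class _ _) dE; rewrite !H1classD => cE.
by apply/eqP; rewrite subr_eq addrAC eq_sym subr_eq -cE.
Qed.

Fact psplit_push_morph (E E' : extension M) (phi : {ghom E -> E'})
  (s : partial_splitting S E) : monoid.monoid_morphism (phi \o s).
Proof. by split=> [|m n] /=; rewrite ?gmulf1 ?gmulfM. Qed.

Lemma rho_ext_push (E E' : extension M) (s : partial_splitting S E)
    (s' : partial_splitting S E') :
  ext_equiv E E' -> rho_ext s = rho_ext s'.
Proof.
move=> [phi [phii phip]].
pose t0 : {ghom N -> E'} := HB.pack (phi \o s : N -> E')
  (isUMagmaMorphism.Build N E' (phi \o s) (psplit_push_morph phi s)).
have t0P n : ext_proj E' (t0 n) = iota n by rewrite /= phip psplitP.
rewrite -(rho_ext_split (PartialSplitting t0P) s').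
rewrite /rho_ext; congr H1class; apply/val_inj/funext=> q.
have [g <-] := ses_proj_surj S q; have [x <-] := ext_proj_surj E g.
rewrite [LHS]rho_derE -phip [RHS]rho_derE; congr H1class.
apply/val_inj/funext=> n; apply: (@ext_incl_inj _ _ E').
by rewrite dxE -phii dxE !gmulfM !gmulfV /= phip.
Qed.

Lemma twisted_ext_equiv (f f' : cocycle2 M) :
  H2class f = H2class f' -> ext_equiv (twisted_ext f) (twisted_ext f').
Proof.
move=> /H2class_eq[b bE].
pose phi (x : twisted_ext f) : twisted_ext f' := (x.1 + b x.2, x.2).
have phiM : {morph phi : x y / (x * y)%g}.
  move=> [m g] [n h]; rewrite [RHS]twisted_mulE /phi /=; congr pair.
  rewrite gactD; have /eqP := bE g h; rewrite subr_eq => /eqP ->.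
  rewrite [_ - _ + b g]addrAC [_ - _ + f' g h]addrAC -[LHS]addrA subrK.
  rewrite addrA; congr (_ + _).
  by rewrite [g *> b h + b g]addrC addrACA.
have phi1 : phi 1%g = 1%g.
  by apply: (@mulgI _ (phi 1%g)); rewrite -phiM !mulg1.
pose Phi : {ghom twisted_ext f -> twisted_ext f'} := HB.pack phi
  (isUMagmaMorphism.Build (twisted_ext f) (twisted_ext f') phi (phi1, phiM)).
exists Phi.
split=> // m; congr pair; rewrite /=.
have := bE 1%g 1%g; rewrite mulg1 gact1 subrr add0r => <-.
by rewrite addrA subrK.
Qed.

End RhoIndependence.

Lemma rhoE (N G Q : groupType) (S : ses N G Q) (M : gmodType G)
    (c : H2_1 S M) (E : extension M) (s : partial_splitting S E) :
  ext_class E (sval c) -> rho c = rho_ext s.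
Proof.
have [E' [s' [[f' [f'c E'f']] ->]]] := rhoP c; move=> [f [fc Ef]].
have [phi [phii phip]] := Ef.
pose t0 : {ghom N -> twisted_ext f} := HB.pack (phi \o s : N -> _)
  (isUMagmaMorphism.Build N (twisted_ext f) (phi \o s) (psplit_push_morph phi s)).
have t0P n : ext_proj (twisted_ext f) (t0 n) = ses_incl S n.
  by rewrite /= phip psplitP.
rewrite (rho_ext_push s (PartialSplitting t0P) Ef).
have [phi' [phii' phip']] := E'f'.
pose t0' : {ghom N -> twisted_ext f'} := HB.pack (phi' \o s' : N -> _)
  (isUMagmaMorphism.Build N (twisted_ext f') (phi' \o s') (psplit_push_morph phi' s')).
have t0P' n : ext_proj (twisted_ext f') (t0' n) = ses_incl S n.
  by rewrite /= phip' psplitP.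
rewrite (rho_ext_push s' (PartialSplitting t0P') E'f').
by apply/rho_ext_push/twisted_ext_equiv; rewrite f'c fc.
Qed.

(* Main.v *)
Require Import Defs.
From HB Require Import structures.
From mathcomp Require Import all_boot all_algebra.

(** A cocycle vanishing on [N x N] makes [n |-> (0, n)] a homomorphism from [N]
    to [M x_f G], that is, a lift [s0] of [N] to the extension attached to [f].
    The class [rho c] may be computed from this extension and this lift, with
    [x = (0, g)] chosen over [g].  The derivation [d_x] of the definition is
    then the stated [d_g] on the nose, not merely up to an inner derivation, by
    the computation in [dx_zero_splitting]. *)

Import GRing.Theory.
Local Open Scope ring_scope.

Section ZeroSection.
Variables (N G Q : groupType) (S : ses N G Q) (M : gmodType G).
Variable f : cocycle2 M.
Hypothesis fN : forall m n : N, f (ses_incl S m) (ses_incl S n) = 0.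

Definition zero_section (n : N) : twisted f := (0, ses_incl S n).

Fact zero_section_morph : monoid.monoid_morphism zero_section.
Proof.
have sM : {morph zero_section : m n / (m * n)%g}.
  by move=> m n; rewrite twisted_mulE /= fN gact0 !addr0 -gmulfM.
by split=> //; apply: (@mulgI _ (zero_section 1%g)); rewrite -sM !mulg1.
Qed.

Definition zero_section_hom : {ghom N -> twisted_ext f} :=
  HB.pack zero_section (isUMagmaMorphism.Build N (twisted_ext f) zero_section
    zero_section_morph).

Definition zero_splitting : partial_splitting S (twisted_ext f) :=
  @PartialSplitting _ _ _ S M (twisted_ext f) zero_section_hom (fun=> erefl).

(** In the twisted product [m : M] embeds as [(m - f(1, 1), 1)], and [f(1, 1)]
    vanishes because [1] lies in [N].  The equation to compare is therefore
    [(d_x n, 1) (0, n) (0, g) = (0, g) (0, g^-1 n g)], with first components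
    [d_x n + f(n, g)] and [f(g, g^-1 n g)]. *)
Lemma dx_zero_splitting (g : G) (n : N) :
  dx zero_splitting ((0, g) : twisted f) n
  = f g (g^-1 * ses_incl S n * g)%g - f (ses_incl S n) g :> M.
Proof.
have f11 : f 1%g 1%g = 0 by rewrite -(gmulf1 (s := ses_incl S)) fN.
have := dxE zero_splitting ((0, g) : twisted f) n.
move/(canLR (mulgVK _))/(canLR (mulgVK _)) => /(congr1 fst) /=.
rewrite gact1 !gact0 (cocycle2_1l f) f11 subr0 !addr0 mul1g add0r.
by rewrite ses_conjE => <-; rewrite addrK.
Qed.

End ZeroSection.

Theorem mainTheorem5 (N G Q : groupType) (S : ses N G Q) (M : gmodType G)
    (c : H2_1 S M) (f : cocycle2 M)
    (fc : H2class f = sval c)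
    (fN : forall m n : N, f (ses_incl S m) (ses_incl S n) = 0) :
  exists (d : G -> derN S M) (D : der (H1N S M)),
    [/\ forall (g : G) (n : N),
          d g n = f g (g^-1 * ses_incl S n * g)%g - f (ses_incl S n) g :> M,
        forall g : G, D (ses_proj S g) = H1class (d g)
      & rho c = H1class D].
Proof.
pose s := zero_splitting _ _ _ S _ f fN.
exists (fun g => dx s ((0, g) : twisted f)), (rho_der s).
split=> [g n | g |]; first exact: dx_zero_splitting.
- exact: (rho_derE s ((0, g) : twisted f)).
- apply: rhoE; exists f; split=> //.
  by exists (idfun : {ghom twisted_ext f -> twisted_ext f}).
Qed.
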